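(* Let $M$ be a simple matroid of rank $r(M)$ with $1\le r(M)\leq 3$. Then the coarse flag polynomial $\mathcal{N}_M(Y,T)$ has nonnegative coefficients and satisfies $$\mathcal{N}_M(Y^{-1},T^{-1}) = Y^{-r(M)}\,T^{-(r(M)-1)}\,\mathcal{N}_M(Y,T).$$ Moreover, the polynomial $\mathcal{N}_M(1,T)$ is real-rooted.
   Context: Matroids: a matroid $M=(E,\mathcal{L}(M))$ is given by a finite ground set $E$ and its lattice of flats $\mathcal{L}(M)$ (ordered by inclusion, with bottom $\hat 0$, top $\hat 1=E$, rank function $r(X)$, and $r(M)=r(E)$). It is simple if its rank $0$ flat is $\varnothing$ and all rank $1$ flats are singletons. For flats $X\subseteq X'$, the lattice of flats of the minor $M/X|X'$ is isomorphic to the interval $[X,X']$ of $\mathcal{L}(M)$. The Möbius function is defined by $\mu_M(\hat 0)=1$, $\mu_M(X)=-\sum_{X'<X}\mu_M(X')$. The Poincaré polynomial is $\pi_M(Y)=\sum_{X\in\mathcal{L}(M)}\mu_M(X)(-Y)^{r(X)}$. Put $\overline{\mathcal{L}}(M)=\mathcal{L}(M)\setminus\{\hat 0,\hat 1\}$, and let $\Delta(\overline{\mathcal{L}}(M))$ be the set of all flags (finite chains, including the empty one) in it. For a flag $F=(X_1<\cdots<X_\ell)$, $\ell\ge 0$, with $X_0=\hat 0$, $X_{\ell+1}=\hat 1$, set $|F|=\ell$ and $\pi_F(Y)=\prod_{k=0}^{\ell}\pi_{M/X_k|X_{k+1}}(Y)$. The coarse flag polynomial is $$\mathcal{N}_M(Y,T)=\sum_{F\in\Delta(\overline{\mathcal{L}}(M))}\pi_F(Y)\,T^{|F|}(1-T)^{r(M)-1-|F|}.$$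 Real-rooted means that all complex roots are real (nonzero constants count as real-rooted). *)

(* Defs.v *)
From HB Require Import structures.
From mathcomp Require Import all_boot all_order all_algebra.

Set Implicit Arguments.
Unset Strict Implicit.
Unset Printing Implicit Defensive.

Import Order.TTheory GRing.Theory Num.Theory.
Local Open Scope ring_scope.

Definition covers (U : finType) (L : {set {set U}}) (X Y : {set U}) : bool :=
  [&& Y \in L, X \proper Y
    & [forall Z in L, ~~ ((X \proper Z) && (Z \proper Y))]].

(* A matroid given by its ground set, a finite subset of an ambient finType,
   and its family of flats; the fields are the usual axioms for flats. *)
Record matroid (U : finType) := Matroid {
  ground : {set U};
  flats : {set {set U}};
  flat_sub : forall X, X \in flats -> X \subset ground;
  ground_flat : ground \in flats;
  flatI : forall X Y, X \in flats -> Y \in flats -> X :&: Y \in flats;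
  flat_cover : forall X x, X \in flats -> x \in ground :\: X ->
    exists! Y : {set U}, covers flats X Y /\ x \in Y
}.

Section Minors.
Variables (U : finType) (M : matroid U).

Lemma covers_uniq (L : {set {set U}}) (X Y Z : {set U}) (x : U) :
  (forall A B, A \in L -> B \in L -> A :&: B \in L) ->
  x \notin X -> covers L X Y -> x \in Y -> covers L X Z -> x \in Z -> Y = Z.
Proof.
move=> LI xX /and3P[YL XY /forall_inP hY] xY /and3P[ZL XZ /forall_inP hZ] xZ.
have XI : X \proper Y :&: Z.
  rewrite properE subsetI (proper_sub XY) (proper_sub XZ) /=.
  by apply/subsetPn; exists x; rewrite ?inE ?xY ?xZ.
move: (hY _ (LI _ _ YL ZL)) (hZ _ (LI _ _ YL ZL)).
rewrite XI /= !properE subsetIl subsetIr /= !negbK !subsetI !subxx /= andbT.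
by move=> YZ ZY; apply/eqP; rewrite eqEsubset YZ ZY.
Qed.

Section Restriction.
Variable A : {set U}.
Let L := [set X :&: A | X in flats M].

Let L_sub X : X \in L -> X \subset ground M :&: A.
Proof. by case/imsetP=> Y /flat_sub YE ->; apply: setSI. Qed.

Let L_ground : ground M :&: A \in L.
Proof. by apply/imset_f/ground_flat. Qed.

Let L_I X Y : X \in L -> Y \in L -> X :&: Y \in L.
Proof.
case/imsetP=> F Ff -> /imsetP[G Gf ->]; apply/imsetP.
by exists (F :&: G); [exact: flatI | rewrite setIACA setIid].
Qed.

Let L_cover X x : X \in L -> x \in (ground M :&: A) :\: X ->
  exists! Y : {set U}, covers L X Y /\ x \in Y.
Proof.
move=> /imsetP[F0 F0f X0] /setDP[/setIP[xE xA] xX].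
have hP : (F0 \in flats M) && (F0 :&: A == X) by rewrite F0f X0 eqxx.
have [F /andP[Ff /eqP XF] Fmin] :=
  @arg_minnP _ F0 [pred F | (F \in flats M) && (F :&: A == X)]
    (fun F => #|F|) hP.
have Fsub H : H \in flats M -> X \subset H -> F \subset H.
  move=> Hf XH; apply/setIidPl/eqP; rewrite eqEcard subsetIl /=.
  apply: Fmin; rewrite inE flatI //= setIAC XF; apply/eqP.
  exact/setIidPl.
have xF : x \in ground M :\: F.
  by rewrite inE xE andbT; apply: contra xX => xF; rewrite -XF inE xF.
have [G [[/and3P[Gf FG /forall_inP hG] xG] _]] := flat_cover Ff xF.
have cG : covers L X (G :&: A).
  apply/and3P; split; first exact: imset_f.
    apply/properP; split; first by rewrite -XF setSI ?proper_sub.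
    by exists x; rewrite // inE xG.
  apply/forall_inP => _ /imsetP[H Hf ->]; apply/negP => /andP[XH HG].
  have := hG _ (flatI Hf Gf); rewrite negb_and => /orP[]/negP; apply.
    rewrite properE subsetI (proper_sub FG) Fsub //=; last first.
      by apply: subset_trans (proper_sub XH) (subsetIl _ _).
    apply: contra (proper_subn XH) => HGF.
    rewrite -XF subsetI subsetIr andbT; apply: subset_trans HGF.
    rewrite subsetI subsetIl /=.
    exact: subset_trans (proper_sub HG) (subsetIl _ _).
  rewrite properE subsetIr /=; apply: contra (proper_subn HG) => GH.
  by apply: setSI; apply: subset_trans GH (subsetIl _ _).
exists (G :&: A); split; first by split; rewrite // inE xG.
by move=> Y [cY xY]; apply: (covers_uniq L_I xX cG _ cY xY); rewrite inE xG.
Qed.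

Definition restriction : matroid U := Matroid L_sub L_ground L_I L_cover.

End Restriction.

Section Contraction.
Variable A : {set U}.
Let L := [set X :\: A | X in flats M & (ground M :&: A) \subset X].

Let L_P X : reflect (exists F, [/\ F \in flats M, ground M :&: A \subset F
    & X = F :\: A]) (X \in L).
Proof.
apply: (iffP imsetP) => [[F]|[F [Ff AF ->]]].
  by rewrite inE => /andP[Ff AF] ->; exists F.
by exists F; rewrite // inE Ff.
Qed.

Let L_mono (F G : {set U}) : F \in flats M -> ground M :&: A \subset G ->
  (F :\: A \subset G :\: A) = (F \subset G).
Proof.
move=> Ff AG; apply/idP/idP => [FG|]; last exact: setSD.
apply/subsetP => x xF; case xA: (x \in A).
  by apply: (subsetP AG); rewrite inE xA (subsetP (flat_sub Ff)).
have xFA : x \in F :\: A by rewrite inE xA xF.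
by case/setDP: (subsetP FG _ xFA).
Qed.

Let L_sub X : X \in L -> X \subset ground M :\: A.
Proof. by case/L_P=> F [/flat_sub FE _ ->]; apply: setSD. Qed.

Let L_ground : ground M :\: A \in L.
Proof.
by apply/L_P; exists (ground M); rewrite ground_flat subsetIl.
Qed.

Let L_I X Y : X \in L -> Y \in L -> X :&: Y \in L.
Proof.
case/L_P=> F [Ff AF ->] /L_P[G [Gf AG ->]]; apply/L_P.
by exists (F :&: G); rewrite flatI // subsetI AF AG setDIl.
Qed.

Let L_cover X x : X \in L -> x \in (ground M :\: A) :\: X ->
  exists! Y : {set U}, covers L X Y /\ x \in Y.
Proof.
case/L_P=> F [Ff AF X0] /setDP[/setDP[xE xA] xX].
have xF : x \in ground M :\: F.
  by rewrite inE xE andbT; apply: contra xX => xF; rewrite X0 inE xA.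
have [G [[/and3P[Gf FG /forall_inP hG] xG] _]] := flat_cover Ff xF.
have AG : ground M :&: A \subset G.
  exact: subset_trans AF (proper_sub FG).
have cG : covers L X (G :\: A).
  apply/and3P; split; first by apply/L_P; exists G.
    by rewrite X0 properE !L_mono // -properE.
  apply/forall_inP => _ /L_P[H [Hf AH ->]].
  by rewrite X0 !properE !L_mono // -!properE hG.
exists (G :\: A); split; first by split; rewrite // inE xA.
by move=> Y [cY xY]; apply: (covers_uniq L_I xX cG _ cY xY); rewrite inE xA.
Qed.

Definition contraction : matroid U := Matroid L_sub L_ground L_I L_cover.

End Contraction.
End Minors.

(* M/X|X' *)
Definition minor (U : finType) (M : matroid U) (X X' : {set U}) : matroid U :=
  restriction (contraction M X) X'.

Lemma flats_minor (U : finType) (M : matroid U) (X X' : {set U}) :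
  X \in flats M -> X' \in flats M -> X \subset X' ->
  flats (minor M X X') =
    [set Z :\: X | Z in flats M & (X \subset Z) && (Z \subset X')].
Proof.
move=> Xf X'f XX'; have XE := setIidPr (flat_sub Xf).
apply/setP => W; apply/imsetP/imsetP => [[V] | [Z]].
  case/imsetP=> Z; rewrite inE XE => /andP[Zf XZ] -> ->.
  exists (Z :&: X'); last by rewrite setIDAC.
  by rewrite inE flatI // subsetI XZ XX' subsetIr.
rewrite inE => /and3P[Zf XZ ZX'] ->; exists (Z :\: X).
  by apply/imsetP; exists Z; rewrite // inE XE Zf.
by rewrite (setIidPl _) //; apply: subset_trans ZX'; apply: subsetDl.
Qed.

Definition bottom (U : finType) (M : matroid U) : {set U} :=
  \bigcap_(X in flats M) X.

Definition chain (U : finType) (C : {set {set U}}) : bool :=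
  [forall A in C, forall B in C, (A \subset B) || (B \subset A)].

(* The rank of X in the lattice of flats, i.e. the length of a longest chain
   of flats from the bottom to X; only meant for X a flat. *)
Definition rank (U : finType) (M : matroid U) (X : {set U}) : nat :=
  (\max_(C : {set {set U}} |
      [&& C \subset flats M, chain C & [forall A in C, A \subset X]]) #|C|).-1.

Definition mrank (U : finType) (M : matroid U) : nat := rank M (ground M).

Definition simple_matroid (U : finType) (M : matroid U) : Prop :=
  (forall X, X \in flats M -> rank M X = 0%N -> X = set0) /\
  (forall X, X \in flats M -> rank M X = 1%N -> exists x, X = [set x]).

(* n bounds the recursion depth; #|X|.+1 is always enough, see mobiusE. *)
Fixpoint mobius_rec (U : finType) (M : matroid U) (n : nat) (X : {set U}) :
    int :=
  if n is n'.+1 then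
    if X == bottom M then 1
    else - \sum_(Z in flats M | Z \proper X) mobius_rec M n' Z
  else 0.

Definition mobius (U : finType) (M : matroid U) (X : {set U}) : int :=
  mobius_rec M #|X|.+1 X.

Lemma mobiusE (U : finType) (M : matroid U) (X : {set U}) :
  mobius M X = if X == bottom M then 1
               else - \sum_(Z in flats M | Z \proper X) mobius M Z.
Proof.
have fuel n m (Y : {set U}) : (#|Y| < n)%N -> (#|Y| < m)%N ->
    mobius_rec M n Y = mobius_rec M m Y.
  elim: n m Y => [|n IH] [|m] Y //= Yn Ym; case: ifP => // _; congr (- _).
  apply: eq_bigr => Z /andP[_ /proper_card ZY].
  by apply: IH; apply: leq_trans ZY _.
rewrite {1}/mobius /=; case: ifP => // _; congr (- _).
apply: eq_bigr => Z /andP[_ /proper_card ZY]; exact: fuel.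
Qed.

Definition poincare (U : finType) (M : matroid U) : {poly int} :=
  \sum_(X in flats M) mobius M X *: (- 'X) ^+ rank M X.

Definition proper_flats (U : finType) (M : matroid U) : {set {set U}} :=
  flats M :\: [set bottom M; ground M].

Definition flag (U : finType) (M : matroid U) (F : {set {set U}}) : bool :=
  (F \subset proper_flats M) && chain F.

(* The sequence bottom = X_0 < X_1 < ... < X_l < X_(l+1) = ground attached to
   the flag F = {X_1 < ... < X_l}. *)
Definition flag_seq (U : finType) (M : matroid U) (F : {set {set U}}) :
    seq {set U} :=
  bottom M ::
    rcons (sort (fun A B : {set U} => A \subset B) (enum F)) (ground M).

Definition flag_poincare (U : finType) (M : matroid U) (F : {set {set U}}) :
    {poly int} :=
  \prod_(k < #|F|.+1)
    poincare (minor M (nth set0 (flag_seq M F) k)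
                      (nth set0 (flag_seq M F) k.+1)).

(* Z[Y][T]: the outer indeterminate is T, the inner one is Y. *)
Definition coarse_flag_poly (U : finType) (M : matroid U) :
    {poly {poly int}} :=
  \sum_(F | flag M F)
    (flag_poincare M F)%:P * 'X ^+ #|F| * (1 - 'X) ^+ (mrank M - 1 - #|F|).

Definition eval2 (K : comNzRingType) (N : {poly {poly int}}) (y t : K) : K :=
  (map_poly (map_poly (fun c : int => c%:~R)) N).[t%:P].[y].

Definition evalY (N : {poly {poly int}}) (y : int) : {poly int} :=
  map_poly (fun q : {poly int} => q.[y]) N.

Notation ratfun := {fraction {poly {poly int}}}.
Definition varT : ratfun := tofrac 'X.
Definition varY : ratfun := tofrac ('X%:P).

(* C ranges over all algebraically closed fields with a conjugation, which
   include the complex numbers R[i] (R a realType) and algC.  The zero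
   polynomial is not real-rooted; nonzero constants are. *)
Definition real_rooted (p : {poly int}) : Prop :=
  forall (C : numClosedFieldType) (z : C), root (map_poly (fun c : int => c%:~R) p) z ->
    z \is Num.real.

(* Main.v *)
Require Import Defs.
From mathcomp Require Import all_boot all_order all_algebra.
From mathcomp Require Import ring lra zify.

(** In rank at most 3 the coarse flag polynomial only depends on a few
    counts, and it can be written down explicitly.  Let [n] be the number of
    flats of rank 1 (points), [c] the number of flats of rank 2 (lines) and [I]
    the number of incident pairs point < line.

    Every interval cut out by a nonempty flag has rank 1 or 2.  An interval of
    rank 1 has Poincare polynomial 1 + Y, and one of rank 2 with [m] intermediate
    flats has (1 + Y)(1 + (m - 1)Y).  Summing these over points or over lines is
    linear in [m], so only [n], [c] and [I] survive.  Together with the Poincare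
    polynomial of the whole matroid, computed from its Whitney numbers, this
    gives N = 1 + Y in rank 1,
      N = (1 + Y) ((1 + bY) + (b + Y)T),   b = n - 1,
    in rank 2, and in rank 3
      N = (1 + Y) ((1 + aY + wY^2) + (s + dY + sY^2)T + (w + aY + Y^2)T^2)
    with a = n - 1, w = 1 - n + I - c, s = n + c - 2 and d = 2(I - n + 1)
    ([coarse_flag_poly_mrank1], [coarse_flag_poly_mrank2],
    [coarse_flag_poly_mrank3]).

    The functional equation is now the visible symmetry of these arrays of
    coefficients.  Since n >= 1 and c >= 1, nonnegativity comes down to
    n + c <= I + 1 ([points_lines_incidences]): fix a point p; every
    other point lies on a line through p, and every line contains some point.
    This is where the axioms for flats enter: two points always lie on a common
    line ([line_through]).
    At Y = 1 the bracket in rank 3 is A + BT + AT^2 with A = I - c + 1 and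
    B = 2(I + c - 1).  The same inequality gives A >= n > 0, and c >= 1 gives
    B >= 2A, so the discriminant is nonnegative and the roots are real. *)

Set Implicit Arguments.
Unset Strict Implicit.
Unset Printing Implicit Defensive.

Import Order.TTheory GRing.Theory Num.Theory.
Local Open Scope ring_scope.

(** * Ranks of flats *)

Lemma bottom_flat (U : finType) (M : matroid U) : bottom M \in flats M.
Proof.
have sub : bottom M \subset ground M.
  by exact: (bigcap_inf (F := id) _ (ground_flat M)).
rewrite -(setIidPr sub) /bottom.
apply: (big_ind (fun X => ground M :&: X \in flats M)).
- by rewrite setIT ground_flat.
- by move=> A B Af Bf; rewrite -[ground M]setIid setIACA; apply: flatI.
- by move=> X Xf; rewrite (setIidPr (flat_sub Xf)).
Qed.

Lemma bottom_sub (U : finType) (M : matroid U) (X : {set U}) :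
  X \in flats M -> bottom M \subset X.
Proof. by move=> Xf; exact: (bigcap_inf (F := id) X Xf). Qed.

Lemma bottom_eq (U : finType) (M : matroid U) (B : {set U}) : B \in flats M ->
  (forall X, X \in flats M -> B \subset X) -> bottom M = B.
Proof.
move=> Bf minB; apply/eqP; rewrite eqEsubset bottom_sub // minB //.
exact: bottom_flat.
Qed.

Lemma bottom_proper (U : finType) (M : matroid U) (X : {set U}) :
  X \in flats M -> X != bottom M -> bottom M \proper X.
Proof. by move=> Xf Xb; rewrite properEneq eq_sym Xb bottom_sub. Qed.

Lemma chain_rank (U : finType) (M : matroid U) (C : {set {set U}})
    (X : {set U}) :
  C \subset flats M -> chain C -> (forall A, A \in C -> A \subset X) ->
  (#|C| <= (rank M X).+1)%N.
Proof.
move=> CM chC CX; apply: leq_trans (leqSpred _).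
apply: (@leq_bigmax_cond _ _ (fun C : {set {set U}} => #|C|)).
by rewrite CM chC; apply/forall_inP.
Qed.

Lemma rank_chain (U : finType) (M : matroid U) (X : {set U}) :
  X \in flats M ->
  exists C : {set {set U}}, [/\ C \subset flats M, chain C,
    forall A, A \in C -> A \subset X & #|C| = (rank M X).+1].
Proof.
move=> Xf; set P := fun C : {set {set U}} =>
      [&& C \subset flats M, chain C & [forall A in C, A \subset X]].
have P1 : P [set X].
  rewrite /P sub1set Xf /=; apply/andP; split.
    apply/forall_inP=> A /set1P->; apply/forall_inP=> B /set1P->.
    by rewrite subxx.
  by apply/forall_inP=> A /set1P->.
have [C /and3P[CM chC /forall_inP CX] Cmax] :
    {C | P C & \max_(C | P C) #|C| = #|C|}.
  by apply: eq_bigmax_cond; apply/card_gt0P; exists [set X].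
exists C; split=> //; rewrite /rank Cmax prednK // -Cmax.
by apply: leq_trans (leq_bigmax_cond _ P1); rewrite cards1.
Qed.

(** A longest chain below [X] gets longer by adding [Y]. *)
Lemma rank_lt (U : finType) (M : matroid U) (X Y : {set U}) :
  X \in flats M -> Y \in flats M -> X \proper Y -> (rank M X < rank M Y)%N.
Proof.
move=> Xf Yf XY; have [C [CM /forall_inP chC CX cardC]] := rank_chain Xf.
have YC : Y \notin C by apply: contra (proper_subn XY) => /CX.
have subY A : A \in C -> A \subset Y.
  by move=> /CX AX; apply: subset_trans AX (proper_sub XY).
rewrite -ltnS -cardC -[(#|C| < _)%N]/(1 + #|C| <= _)%N.
rewrite -[1%N]/(true : nat) -YC -cardsU1.
apply: chain_rank.
- by rewrite subUset sub1set Yf.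
- apply/forall_inP=> A /setU1P[->|AC]; apply/forall_inP=> B /setU1P[->|BC].
  + by rewrite subxx.
  + by rewrite (subY B) ?orbT.
  + by rewrite (subY A).
  + exact: (forall_inP (chC A AC)).
- by move=> A /setU1P[->|/subY].
Qed.

Lemma rank_bottom (U : finType) (M : matroid U) : rank M (bottom M) = 0%N.
Proof.
have [C [CM _ CX cardC]] := rank_chain (bottom_flat M).
apply/eqP; rewrite -leqn0 -ltnS -cardC -(cards1 (bottom M)); apply: subset_leq_card.
apply/subsetP=> A AC; rewrite inE eqEsubset CX // bottom_sub //.
exact: (subsetP CM).
Qed.

Lemma rank_gt0 (U : finType) (M : matroid U) (X : {set U}) :
  X \in flats M -> (0 < rank M X)%N = (X != bottom M).
Proof.
move=> Xf; apply/idP/idP => [|Xb].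
  by apply: contraTneq => ->; rewrite rank_bottom.
by rewrite -(rank_bottom M) rank_lt ?bottom_flat ?bottom_proper.
Qed.

(** The second largest member of a longest chain below [Y] is such an [X].
    Together with [rank_lt] this says that the rank of [Y] is one more than the
    largest rank of a flat strictly below it. *)
Lemma rank_pred (U : finType) (M : matroid U) (Y : {set U}) :
  Y \in flats M -> Y != bottom M ->
  exists2 X, X \in flats M & X \proper Y /\ rank M Y = (rank M X).+1.
Proof.
move=> Yf; rewrite -rank_gt0 // => rY.
have [C [CM /forall_inP chC CY cardC]] := rank_chain Yf.
have [X0 X0C] : exists X, X \in C :\ Y.
  apply/set0Pn; rewrite -card_gt0.
  move: rY; rewrite -ltnS -cardC (cardsD1 Y).
  by case: (Y \in C) => //; apply: ltnW.
have [X XC Xmax] := arg_maxnP (fun X : {set U} => #|X|) X0C.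
have [XY XinC] := setD1P XC.
have Xf : X \in flats M by apply: (subsetP CM).
have XpY : X \proper Y by rewrite properEneq XY CY.
exists X => //; split=> //; apply/eqP; rewrite eqn_leq (rank_lt Xf Yf XpY) andbT.
rewrite -ltnS -cardC (cardsD1 Y) -add1n leq_add ?leq_b1 //.
apply: chain_rank.
- by apply: subset_trans CM; apply: subsetDl.
- apply/forall_inP=> A /setD1P[_ AC]; apply/forall_inP=> B /setD1P[_ BC].
  exact: (forall_inP (chC A AC)).
- move=> A AC; have [_ AinC] := setD1P AC.
  have /orP[//|XA] := forall_inP (chC A AinC) X XinC.
  suff -> : A = X by [].
  by apply/eqP; rewrite eq_sym eqEcard XA; apply: Xmax.
Qed.

Lemma rank_top (U : finType) (M : matroid U) (X : {set U}) :
  X \in flats M -> (rank M X == mrank M) = (X == ground M).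
Proof.
move=> Xf; apply/eqP/eqP=> [rX|-> //]; apply/eqP/negPn/negP => XE.
have := rank_lt Xf (ground_flat M).
by rewrite -/(mrank M) rX ltnn properEneq XE flat_sub // => /(_ isT).
Qed.

Lemma rank_le (U : finType) (M : matroid U) (X : {set U}) :
  X \in flats M -> (rank M X <= mrank M)%N.
Proof.
move=> Xf; have [/eqP|XE] := eqVneq X (ground M).
  by rewrite -rank_top // => /eqP->.
by apply/ltnW/rank_lt; rewrite ?ground_flat // properEneq XE flat_sub.
Qed.

Lemma in_proper_flats (U : finType) (M : matroid U) (X : {set U}) :
  (X \in proper_flats M) = (X \in flats M) && (0 < rank M X < mrank M)%N.
Proof.
rewrite !inE negb_or andbC; case Xf: (X \in flats M) => //=.
by rewrite rank_gt0 // ltn_neqAle rank_le // rank_top // andbT.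
Qed.

(** * Whitney numbers and Poincare polynomials *)

Definition level (U : finType) (M : matroid U) (i : nat) : {set {set U}} :=
  [set X in flats M | rank M X == i].

Lemma levelP (U : finType) (M : matroid U) (i : nat) (X : {set U}) :
  reflect (X \in flats M /\ rank M X = i) (X \in level M i).
Proof. by rewrite inE; apply: (iffP andP) => [][? /eqP]. Qed.

Lemma level0 (U : finType) (M : matroid U) : level M 0 = [set bottom M].
Proof.
apply/setP=> X; rewrite !inE; apply/andP/eqP => [[Xf]|->].
  by rewrite -leqn0 leqNgt rank_gt0 // negbK => /eqP.
by rewrite bottom_flat rank_bottom.
Qed.

Definition whitney (U : finType) (M : matroid U) (i : nat) : int :=
  \sum_(X in level M i) mobius M X.

Lemma sum_by_rank (R : nmodType) (U : finType) (M : matroid U)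
    (f : {set U} -> R) :
  \sum_(X in flats M) f X =
    \sum_(i < (mrank M).+1) \sum_(X in level M i) f X.
Proof.
rewrite (partition_big (fun X => inord (rank M X) : 'I_(mrank M).+1) xpredT) //=.
apply: eq_bigr => i _; apply: eq_bigl => X; rewrite inE.
case Xf: (X \in flats M) => //=.
by rewrite -val_eqE /= inordK // ltnS rank_le.
Qed.

Lemma poincare_whitney (U : finType) (M : matroid U) :
  poincare M = \sum_(i < (mrank M).+1) (whitney M i)%:~R * (- 'X) ^+ i.
Proof.
rewrite /poincare sum_by_rank; apply: eq_bigr => i _.
rewrite mulrzl -scaler_int intz /whitney scaler_suml.
by apply: eq_bigr => X /levelP[_ ->].
Qed.

Lemma level_antichain (U : finType) (M : matroid U) (i : nat) (X Y : {set U}) :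
  X \in level M i -> Y \in level M i -> X \subset Y -> X = Y.
Proof.
case/levelP=> Xf rX /levelP[Yf rY] XY; apply/eqP/negPn/negP=> nXY.
by have := @rank_lt _ M X Y Xf Yf; rewrite properEneq nXY XY rX rY ltnn => /(_ isT).
Qed.

Lemma level_properF (U : finType) (M : matroid U) (i : nat) (X Y : {set U}) :
  X \in level M i -> Y \in level M i -> (X \proper Y) = false.
Proof.
move=> Xi Yi; apply/negP=> XY; move: (XY).
by rewrite (level_antichain Xi Yi (proper_sub XY)) properxx.
Qed.

Lemma whitney0 (U : finType) (M : matroid U) : whitney M 0 = 1.
Proof. by rewrite /whitney level0 big_set1 mobiusE eqxx. Qed.

(** The top value of the Moebius function is determined by the others, so the
    last Whitney number never has to be computed directly. *)
Lemma sum_whitney (U : finType) (M : matroid U) :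
  (0 < mrank M)%N -> \sum_(i < (mrank M).+1) whitney M i = 0.
Proof.
rewrite rank_gt0 ?ground_flat // => Eb.
rewrite /whitney -sum_by_rank (bigD1 (ground M)) ?ground_flat //=.
rewrite mobiusE (negPf Eb) addrC; apply/eqP; rewrite subr_eq0; apply/eqP.
apply: eq_bigl => Z; case Zf: (Z \in flats M) => //=.
by rewrite properEneq flat_sub // andbT.
Qed.

Lemma mobius_level1 (U : finType) (M : matroid U) (X : {set U}) :
  X \in level M 1 -> mobius M X = -1.
Proof.
case/levelP=> Xf rX; have Xb : X != bottom M by rewrite -rank_gt0 // rX.
rewrite mobiusE (negPf Xb) (big_pred1 (bottom M)).
  by rewrite [mobius _ (bottom M)]mobiusE eqxx.
move=> Z /=; apply/andP/eqP => [[Zf ZX]|->].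
  by have := rank_lt Zf Xf ZX; rewrite rX ltnNge rank_gt0 // negbK => /eqP.
by rewrite bottom_flat bottom_proper.
Qed.

Lemma mobius_level2 (U : finType) (M : matroid U) (X : {set U}) :
  X \in level M 2 -> mobius M X = #|[set p in level M 1 | p \proper X]|%:Z - 1.
Proof.
case/levelP=> Xf rX; have Xb : X != bottom M by rewrite -rank_gt0 // rX.
rewrite mobiusE (negPf Xb) (bigD1 (bottom M)) /=; last first.
  by rewrite bottom_flat bottom_proper.
rewrite [mobius _ (bottom M)]mobiusE eqxx opprD addrC; congr (_ - _).
rewrite (eq_big [in [set p in level M 1 | p \proper X]] (fun=> -1)) => [|Z|Z].
- by rewrite sumr_const mulNrn opprK natz.
- rewrite !inE; case Zf: (Z \in flats M) => //=; rewrite andbC.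
  case ZX: (Z \proper X); rewrite ?andbF // !andbT -rank_gt0 //.
  by have := rank_lt Zf Xf ZX; rewrite rX; case: (rank M Z) => [|[]].
case/andP=> /andP[Zf ZX] Zb; apply: mobius_level1; rewrite inE Zf /=.
move: Zb; rewrite -rank_gt0 //.
by have := rank_lt Zf Xf ZX; rewrite rX; case: (rank M Z) => [|[]].
Qed.

Lemma whitney1 (U : finType) (M : matroid U) : whitney M 1 = - #|level M 1|%:Z.
Proof.
rewrite /whitney (eq_bigr (fun=> -1)) => [|X]; last exact: mobius_level1.
by rewrite sumr_const mulNrn natz.
Qed.

Definition incidences (U : finType) (M : matroid U) : nat :=
  \sum_(l in level M 2) #|[set p in level M 1 | p \proper l]|.

Lemma whitney2 (U : finType) (M : matroid U) :
  whitney M 2 = (incidences M)%:Z - #|level M 2|%:Z.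
Proof.
rewrite /whitney (eq_bigr _ (@mobius_level2 _ M)) sumrB sumr_const.
by rewrite -!natz natr_sum; congr (_ - _); apply: eq_bigr => l _; rewrite natz.
Qed.

Lemma poincare_mrank1 (U : finType) (M : matroid U) :
  mrank M = 1%N -> poincare M = 1 + 'X.
Proof.
move=> r1; have := @sum_whitney _ M; rewrite poincare_whitney r1 => /(_ isT).
rewrite !big_ord_recl !big_ord0 /= whitney0 => w1.
have -> : whitney M (bump 0 0) = -1 by lia.
by ring.
Qed.

Lemma poincare_mrank2 (U : finType) (M : matroid U) : mrank M = 2%N ->
  poincare M = (1 + 'X) * (1 + (#|level M 1|%:Z - 1)%:~R * 'X).
Proof.
move=> r2; have := @sum_whitney _ M; rewrite poincare_whitney r2 => /(_ isT).
rewrite !big_ord_recl !big_ord0 /= whitney0 !/bump /= !addnE /= whitney1 => w2.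
have -> : whitney M 2 = #|level M 1|%:Z - 1 by lia.
by ring.
Qed.

Lemma poincare_mrank3 (U : finType) (M : matroid U)
  (n := #|level M 1|%:Z) (c := #|level M 2|%:Z)
  (I := (incidences M)%:Z) :
  mrank M = 3%N ->
  poincare M = (1 + 'X) * (1 + (n - 1)%:~R * 'X + (1 - n + I - c)%:~R * 'X ^+ 2).
Proof.
move=> r3; have := @sum_whitney _ M; rewrite poincare_whitney r3 => /(_ isT).
rewrite !big_ord_recl !big_ord0 /= whitney0 !/bump /= !addnE /= whitney1 whitney2.
rewrite -/n -/c -/I => w3.
have -> : whitney M 3 = - (1 - n + I - c) by lia.
by ring.
Qed.

(** * Intervals of the lattice of flats *)

Lemma setDr_subset (T : finType) (X A B : {set T}) : X \subset B ->
  (A :\: X \subset B :\: X) = (A \subset B).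
Proof.
move=> XB; rewrite subsetD subDset (setUidPr XB).
by rewrite disjoints_subset setDE subsetIr andbT.
Qed.

Lemma setDr_proper (T : finType) (X A B : {set T}) : X \subset A -> X \subset B ->
  (A :\: X \proper B :\: X) = (A \proper B).
Proof. by move=> XA XB; rewrite !properE !setDr_subset. Qed.

Lemma setDr_eq (T : finType) (X A B : {set T}) : X \subset A -> X \subset B ->
  (A :\: X == B :\: X) = (A == B).
Proof. by move=> XA XB; rewrite !eqEsubset !setDr_subset. Qed.

Lemma flat_minor (U : finType) (M : matroid U) (X Y Z : {set U}) :
  X \in flats M -> Y \in flats M -> Z \in flats M ->
  X \subset Z -> Z \subset Y -> Z :\: X \in flats (minor M X Y).
Proof.
move=> Xf Yf Zf XZ ZY; rewrite flats_minor ?(subset_trans XZ ZY) //.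
by apply/imsetP; exists Z; rewrite // inE Zf XZ.
Qed.

Lemma bottom_minor (U : finType) (M : matroid U) (X Y : {set U}) :
  X \in flats M -> Y \in flats M -> X \subset Y -> bottom (minor M X Y) = X :\: X.
Proof.
move=> Xf Yf XY; apply: bottom_eq => [|Z _]; last by rewrite setDv sub0set.
exact: flat_minor.
Qed.

Lemma ground_minor (U : finType) (M : matroid U) (X Y : {set U}) :
  Y \in flats M -> ground (minor M X Y) = Y :\: X.
Proof. by move=> Yf; rewrite /= setIDAC (setIidPr (flat_sub Yf)). Qed.

Lemma card_proper_flats_minor (U : finType) (M : matroid U) (X Y : {set U}) :
  X \in flats M -> Y \in flats M -> X \subset Y ->
  #|proper_flats (minor M X Y)| =
    #|[set Z in flats M | (X \proper Z) && (Z \proper Y)]|.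
Proof.
move=> Xf Yf XY; rewrite -[RHS](card_in_imset (f := fun Z => Z :\: X)); last first.
  move=> Z Z'; rewrite !inE => /and3P[_ /proper_sub XZ _] /and3P[_ /proper_sub XZ' _].
  by move/eqP; rewrite setDr_eq // => /eqP.
apply: eq_card => W; rewrite inE bottom_minor // ground_minor // flats_minor //.
apply/andP/imsetP => [[Wn /imsetP[Z]]|[Z]]; rewrite inE => /and3P[Zf XZ ZY] WE.
  move: Wn; rewrite !inE WE !setDr_eq // negb_or => /andP[ZX ZY'].
  by exists Z; rewrite // inE Zf !properEneq XZ ZY eq_sym ZX ZY'.
rewrite WE; split; last by apply/imsetP; exists Z; rewrite // inE Zf !proper_sub.
rewrite !inE !setDr_eq ?(proper_sub XZ) // negb_or eq_sym.
by move: XZ ZY; rewrite !properEneq => /andP[-> _] /andP[-> _].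
Qed.

(** Chains in the interval above [X] prolong chains below [X]. *)
Lemma rank_minor_le (U : finType) (M : matroid U) (X Y Z : {set U}) :
  X \in flats M -> Y \in flats M -> X \subset Z -> Z \subset Y -> Z \in flats M ->
  (rank (minor M X Y) (Z :\: X) + rank M X <= rank M Z)%N.
Proof.
move=> Xf Yf; set N := minor M X Y.
have [r] := ubnP (rank N (Z :\: X)); elim: r Z => // r IH Z rZ XZ ZY Zf.
have XY := subset_trans XZ ZY; have bN : bottom N = X :\: X by apply: bottom_minor.
have fZ : Z :\: X \in flats N by exact: flat_minor.
have [/eqP|Zb] := eqVneq (Z :\: X) (bottom N).
  by rewrite bN setDr_eq // => /eqP->; rewrite -bN rank_bottom.
have [W + [+ +]] := rank_pred fZ Zb.
rewrite {1}flats_minor // => /imsetP[Z' + ->]; rewrite inE => /and3P[Z'f XZ' Z'Y].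
rewrite setDr_proper // => Z'Z rZZ'.
have := IH Z'; rewrite -ltnS -rZZ' rZ => /(_ isT XZ' Z'Y Z'f).
by rewrite rZZ' addSn => le; apply: leq_ltn_trans le (rank_lt Z'f Zf Z'Z).
Qed.

Lemma mrank_minor_le (U : finType) (M : matroid U) (X Y : {set U}) :
  X \in flats M -> Y \in flats M -> X \subset Y ->
  (mrank (minor M X Y) + rank M X <= rank M Y)%N.
Proof. by move=> Xf Yf XY; rewrite /mrank ground_minor // rank_minor_le. Qed.

Lemma mrank_minor_gt0 (U : finType) (M : matroid U) (X Y : {set U}) :
  X \in flats M -> Y \in flats M -> X \proper Y -> (0 < mrank (minor M X Y))%N.
Proof.
move=> Xf Yf /[dup] XY /proper_sub XsY; rewrite rank_gt0 ?ground_flat //.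
by rewrite ground_minor // bottom_minor // setDr_eq // eq_sym proper_neq.
Qed.

Lemma poincare_minor1 (U : finType) (M : matroid U) (X Y : {set U}) :
  X \in flats M -> Y \in flats M -> X \proper Y -> rank M Y = (rank M X).+1 ->
  poincare (minor M X Y) = 1 + 'X.
Proof.
move=> Xf Yf XY rY; apply: poincare_mrank1.
have := mrank_minor_le Xf Yf (proper_sub XY); have := mrank_minor_gt0 Xf Yf XY.
by lia.
Qed.

Lemma level1_mrank2 (U : finType) (M : matroid U) :
  mrank M = 2%N -> level M 1 = proper_flats M.
Proof.
move=> r2; apply/setP=> X; rewrite in_proper_flats inE r2.
by case: (rank M X) => [|[]].
Qed.

(** The intermediate flat [Z] forces the interval to have rank exactly 2. *)
Lemma poincare_minor2 (U : finType) (M : matroid U) (X Y Z : {set U}) :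
  X \in flats M -> Y \in flats M -> Z \in flats M ->
  X \proper Z -> Z \proper Y -> rank M Y = (rank M X).+2 ->
  poincare (minor M X Y) = (1 + 'X) * (1 +
    (#|[set Z in flats M | (X \proper Z) && (Z \proper Y)]|%:Z - 1)%:~R * 'X).
Proof.
move=> Xf Yf Zf XZ ZY rY; have XY := proper_sub (proper_trans XZ ZY).
have mid : (0 < #|proper_flats (minor M X Y)|)%N.
  by rewrite card_proper_flats_minor //; apply/card_gt0P; exists Z; rewrite inE Zf XZ.
have r2 : mrank (minor M X Y) = 2%N.
  have := mrank_minor_le Xf Yf XY.
  case/card_gt0P: mid => W; rewrite in_proper_flats => /and3P[_]; lia.
by rewrite poincare_mrank2 // level1_mrank2 // card_proper_flats_minor.
Qed.

Lemma poincare_flats (U : finType) (M N : matroid U) :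
  flats M = flats N -> poincare M = poincare N.
Proof.
move=> fE; have bE : bottom M = bottom N by rewrite /bottom fE.
have rE (X : {set U}) : rank M X = rank N X by rewrite /rank fE.
have muE (X : {set U}) : mobius M X = mobius N X.
  rewrite /mobius; move: #|X|.+1 => n; elim: n X => //= n IH X; rewrite bE fE.
  by case: ifP => // _; congr (- _); apply: eq_bigr => Z _.
by rewrite /poincare fE; apply: eq_bigr => X _; rewrite muE rE.
Qed.

Lemma simple_bottom (U : finType) (M : matroid U) :
  simple_matroid M -> bottom M = set0.
Proof. by case=> sM _; apply: sM; rewrite ?bottom_flat ?rank_bottom. Qed.

(** The minor spanned by the whole lattice deletes the bottom from every flat;
    it has the flats of [M] itself because simplicity makes the bottom empty. *)
Lemma poincare_minor_full (U : finType) (M : matroid U) : simple_matroid M ->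
  poincare (minor M (bottom M) (ground M)) = poincare M.
Proof.
move=> sM; apply: poincare_flats.
rewrite flats_minor ?bottom_flat ?ground_flat ?bottom_sub ?ground_flat //.
rewrite simple_bottom //; apply/setP => X; apply/imsetP/idP => [[Z]|Xf].
  by rewrite inE setD0 => /andP[Zf _] ->.
by exists X; rewrite ?setD0 // inE Xf sub0set flat_sub.
Qed.

(** * Sums over flags *)

(** Adding the bottom and the top to a flag gives a chain of flats, so its
    length is at most [mrank M]. *)
Lemma card_flag (U : finType) (M : matroid U) (F : {set {set U}}) :
  (0 < mrank M)%N -> flag M F -> (#|F| < mrank M)%N.
Proof.
move=> r0 /andP[FP chF].
have Eb : ground M != bottom M by rewrite -rank_gt0 ?ground_flat.
have FM A : A \in F -> A \in flats M by move/(subsetP FP); case/setDP.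
pose C := bottom M |: (ground M |: F).
have CM A : A \in C -> A \in flats M.
  by case/setU1P=> [->|/setU1P[->|/FM//]]; rewrite ?bottom_flat ?ground_flat.
have: (#|C| <= (mrank M).+1)%N.
  apply: chain_rank => [||A /CM]; [exact/subsetP| |exact: flat_sub].
  have comp (A B : {set U}) : A \in C -> B \in C ->
      (A \subset B) || (B \subset A) || ((A \in F) && (B \in F)).
    move=> Ain Bin; case/setU1P: (Ain) => [->|/setU1P[->|AF]].
        by rewrite bottom_sub ?CM.
      by rewrite (flat_sub (CM B Bin)) orbT.
    case/setU1P: (Bin) => [->|/setU1P[->|BF]]; last by rewrite AF BF orbT.
      by rewrite bottom_sub ?CM ?orbT.
    by rewrite (flat_sub (CM A Ain)).
  apply/forall_inP=> A Ain; apply/forall_inP=> B Bin.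
  case/orP: (comp A B Ain Bin) => // /andP[AF BF].
  by have /forall_inP/(_ A AF)/forall_inP/(_ B BF) := chF.
have bF : bottom M \notin F.
  by apply/negP=> /(subsetP FP); rewrite !inE eqxx.
have gF : ground M \notin F.
  by apply/negP=> /(subsetP FP); rewrite !inE eqxx orbT.
by rewrite !cardsU1 gF !inE negb_or eq_sym Eb bF.
Qed.

Lemma flag0 (U : finType) (M : matroid U) : flag M set0.
Proof. by rewrite /flag sub0set; apply/forall_inP=> A; rewrite inE. Qed.

Lemma flag1 (U : finType) (M : matroid U) (X : {set U}) :
  flag M [set X] = (X \in proper_flats M).
Proof.
rewrite /flag sub1set andbC; case: (X \in proper_flats M); rewrite ?andbF // andbT.
by apply/forall_inP=> A /set1P->; apply/forall_inP=> B /set1P->; rewrite subxx.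
Qed.

Lemma flag2 (U : finType) (M : matroid U) (X Y : {set U}) :
  flag M [set X; Y] = [&& X \in proper_flats M, Y \in proper_flats M
                        & (X \subset Y) || (Y \subset X)].
Proof.
rewrite /flag subUset !sub1set -andbA; do 2!congr (_ && _).
apply/forall_inP/idP => [/(_ X)|XY A].
  by rewrite set21 => /(_ isT)/forall_inP/(_ Y); apply; rewrite set22.
by case/set2P=> ->; apply/forall_inP=> B /set2P[]->; rewrite ?subxx // orbC.
Qed.

(** For rank at most 3 no flag has more than two members, by [card_flag]. *)
Lemma sum_flags (R : nmodType) (U : finType) (M : matroid U)
    (g : {set {set U}} -> R) :
  (0 < mrank M <= 3)%N ->
  \sum_(F | flag M F) g F =
    g set0 + (\sum_(X in proper_flats M) g [set X] +
      \sum_(X in proper_flats M) \sum_(Y in proper_flats M | X \proper Y)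
        g [set X; Y]).
Proof.
case/andP=> r0 r3; rewrite (bigD1 set0) ?flag0 //=; congr (_ + _).
rewrite (bigID (fun F : {set {set U}} => #|F| == 1%N)) /=; congr (_ + _).
  rewrite -(big_imset _ (h := fun X => [set X])) /=; last by move=> X Y _ _ /set1_inj.
  apply: eq_bigl => F; apply/andP/imsetP => [[/andP[fF _] /cards1P[X FX]]|[X Xp ->]].
    by exists X; rewrite // -flag1 -FX.
  by rewrite flag1 Xp cards1 -card_gt0 cards1.
rewrite pair_big_dep /= -(big_imset _ (h := fun u => [set u.1; u.2])) /=; last first.
  (* A flag X < Y is recovered from the set [set X; Y] as its meet and join. *)
  have ends (X Y : {set U}) : X \proper Y ->
      X = \bigcap_(Z in [set X; Y]) Z /\ Y = \bigcup_(Z in [set X; Y]) Z.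
    move/proper_sub=> XY; rewrite bigcap_setU bigcup_setU !big_set1.
    by rewrite (setIidPl XY) (setUidPr XY).
  move=> [X Y] [X' Y'] /= /andP[_ /andP[_ XY]] /andP[_ /andP[_ XY']] eqF.
  have [Xe Ye] := ends X Y XY; have [Xe' Ye'] := ends X' Y' XY'.
  by move: Xe Ye; rewrite eqF -Xe' -Ye' => -> ->.
apply: eq_bigl => F; apply/andP/imsetP => [[/andP[fF F0] F1]|[[X Y] /= XY ->]].
  have : #|F| == 2%N.
    move: F0 F1 (card_flag r0 fF) r3; rewrite -card_gt0; move: #|F| => k; lia.
  case/cards2P=> X [Y [XY FE]]; move: fF; rewrite FE flag2 => /and3P[Xp Yp /orP[sXY|sYX]].
    by exists (X, Y); rewrite // unfold_in /= Xp Yp properEneq XY.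
  by exists (Y, X); rewrite /= 1?setUC // unfold_in /= Xp Yp properEneq eq_sym XY.
case/andP: XY => Xp /andP[Yp XY]; rewrite flag2 Xp Yp (proper_sub XY) cards2.
by rewrite (proper_neq XY) -card_gt0 cards2.
Qed.

Lemma flag_poincare0 (U : finType) (M : matroid U) :
  flag_poincare M set0 = poincare (minor M (bottom M) (ground M)).
Proof.
by rewrite /flag_poincare /flag_seq cards0 enum_set0 big_ord_recl big_ord0 mulr1.
Qed.

Lemma flag_poincare1 (U : finType) (M : matroid U) (X : {set U}) :
  flag_poincare M [set X] =
    poincare (minor M (bottom M) X) * poincare (minor M X (ground M)).
Proof.
by rewrite /flag_poincare /flag_seq cards1 enum_set1 !big_ord_recl big_ord0 mulr1.
Qed.

Lemma flag_poincare2 (U : finType) (M : matroid U) (X Y : {set U}) : X \proper Y ->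
  flag_poincare M [set X; Y] = poincare (minor M (bottom M) X) *
    (poincare (minor M X Y) * poincare (minor M Y (ground M))).
Proof.
move=> XY; rewrite /flag_poincare /flag_seq cards2 (proper_neq XY).
have XYs : perm_eq (enum [set X; Y]) [:: X; Y].
  apply: uniq_perm; rewrite ?enum_uniq //= ?inE ?(proper_neq XY) // => Z.
  by rewrite mem_enum !inE.
(* The enumeration lists X and Y in an unspecified order; both cases are sorted
   by computation. *)
have -> : sort (fun A B : {set U} => A \subset B) (enum [set X; Y]) = [:: X; Y].
  have := perm_size XYs; case: (enum _) XYs => [|A [|B []]] //= XYs _.
  have := perm_mem XYs A; have := perm_mem XYs B; have := perm_uniq XYs.
  rewrite /= !inE !eqxx !orbT /= (proper_neq XY) andbT => AB.
  move=> /esym/orP[]/eqP BE /esym/orP[]/eqP AE; move: AB; rewrite AE BE ?eqxx //.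
    by rewrite /sort /= /merge (negPf (proper_subn XY)).
  by rewrite /sort /= /merge (proper_sub XY).
by rewrite !big_ord_recl big_ord0 mulr1.
Qed.

(** * Points and lines in rank 3 *)

(** A cover [Y] of [X] through an element [x] of [q] outside [X] meets [q] in a
    flat containing [x]; this is not the bottom, so it is [q]. *)
Lemma cover_join (U : finType) (M : matroid U) (X q : {set U}) :
  X \in flats M -> q \in level M 1 -> ~~ (q \subset X) ->
  exists2 Y, covers (flats M) X Y & q \subset Y.
Proof.
move=> Xf /levelP[qf rq] /subsetPn[x xq xX].
have xEX : x \in ground M :\: X by rewrite inE xX (subsetP (flat_sub qf)).
have [Y [[cY xY] _]] := flat_cover Xf xEX; exists Y => //.
have Yf : Y \in flats M by case/and3P: cY.
apply: contraT => qY; have If := flatI Yf qf.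
have : Y :&: q \proper q.
  by rewrite properE subsetIr subsetI negb_and qY.
move/(rank_lt If qf); rewrite rq ltnS leqn0 => /eqP rI.
have xI : x \in Y :&: q by rewrite inE xY.
have : Y :&: q \in level M 0 by apply/levelP.
rewrite level0 inE => /eqP Ib; move: xI; rewrite Ib => /(subsetP (bottom_sub Xf)).
by rewrite (negPf xX).
Qed.

Lemma sum_linear_factors (R : comNzRingType) (T : finType) (y : R) (S : {set T})
    (k : T -> nat) :
  \sum_(X in S) (1 + ((k X)%:Z - 1)%:~R * y) =
    #|S|%:Z%:~R + ((\sum_(X in S) k X)%N%:Z - #|S|%:Z)%:~R * y.
Proof.
rewrite -[(\sum_(X in S) k X)%N%:Z]natz natr_sum -sum1_card.
rewrite -[(\sum_(X in S) 1)%N%:Z]natz natr_sum.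
rewrite -sumrB !rmorph_sum big_distrl -big_split; apply: eq_bigr => X _ /=.
by rewrite !natz.
Qed.

Section RankThree.
Variables (U : finType) (M : matroid U).
Hypothesis r3 : mrank M = 3%N.

Local Notation points := (level M 1).
Local Notation lines := (level M 2).

Lemma exists_line : exists l, l \in lines.
Proof.
have [|l lf [_ rl]] := rank_pred (ground_flat M).
  by rewrite -rank_gt0 ?ground_flat // -/(mrank M) r3.
by exists l; apply/levelP; split=> //; move: rl; rewrite -/(mrank M) r3 => -[].
Qed.

Lemma exists_point l : l \in lines -> exists2 p, p \in points & p \proper l.
Proof.
case/levelP=> lf rl; have [|p pf [pl rp]] := rank_pred lf.
  by rewrite -rank_gt0 // rl.
by exists p => //; apply/levelP; split=> //; move: rp; rewrite rl => -[].
Qed.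

(** Here [l] rules out that the cover [Y] is the ground set. *)
Lemma cover_point_line p l Y : p \in points -> l \in lines -> p \proper l ->
  covers (flats M) p Y -> Y \in lines.
Proof.
case/levelP=> pf rp /levelP[lf rl] pl /and3P[Yf pY /forall_inP minY].
have YE : Y != ground M.
  apply: contraTneq (minY l lf) => ->.
  rewrite pl negbK properEneq flat_sub // andbT.
  by rewrite -rank_top // rl r3.
have := rank_lt pf Yf pY; have := rank_le Yf; rewrite leq_eqVlt rank_top // (negPf YE).
by rewrite r3 rp => /= ? ?; apply/levelP; split => //; lia.
Qed.

(** Some point [a] lies on some line; the join of [a] and [p] is a line by
    [cover_point_line]. *)
Lemma point_on_line p : p \in points -> exists2 l, l \in lines & p \proper l.
Proof.
move=> pP; have [l lL] := exists_line; have [a aP al] := exists_point lL.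
have [->|pa] := eqVneq p a; first by exists l.
case/levelP: (aP) => af _.
have [|Y cY pY] := cover_join af pP.
  by apply: contra pa => /(level_antichain pP aP)->.
have YL := cover_point_line aP lL al cY; exists Y => //; rewrite properEneq pY andbT.
by apply: contraTneq YL => <-; rewrite inE; case/levelP: pP => _ ->; rewrite andbF.
Qed.

Lemma line_through p q : p \in points -> q \in points -> p != q ->
  exists2 l, l \in lines & (p \proper l) && (q \proper l).
Proof.
move=> pP qP pq; have [l lL pl] := point_on_line pP.
case/levelP: (pP) => pf _; have [|Y cY qY] := cover_join pf qP.
  by apply: contra pq => /(level_antichain qP pP)->.
have YL := cover_point_line pP lL pl cY; exists Y => //.
case/and3P: cY => _ -> _; rewrite properEneq qY andbT.
by apply: contraTneq YL => <-; rewrite inE; case/levelP: qP => _ ->; rewrite andbF.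
Qed.

(** Fix a point [p].  Each line carries at least one incidence, which for the
    lines through [p] may be taken to be [p] itself; the remaining points on the
    lines through [p] cover all the points other than [p]. *)
Lemma points_lines_incidences : (#|points| + #|lines| <= incidences M + 1)%N.
Proof.
have [l lL] := exists_line; have [p pP _] := exists_point lL.
pose on (l : {set U}) := [set q in points | q \proper l].
have cover : points :\ p \subset \bigcup_(l in lines | p \proper l) (on l :\ p).
  apply/subsetP=> q /setD1P[qp qP]; have [m mL /andP[pm qm]] := line_through qP pP qp.
  by apply/bigcupP; exists m; rewrite ?mL // !inE qp; move: qP; rewrite !inE => ->.
have le_on : (\sum_(l in lines | p \proper l) #|on l :\ p| + #|lines| <= incidences M)%N.
  rewrite big_mkcondr -sum1_card -big_split /=; apply: leq_sum => m mL.
  have [q qP qm] := exists_point mL; case: ifP => pm.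
    by rewrite (cardsD1 p (on m)) inE pP pm addnC.
  by apply/card_gt0P; exists q; rewrite inE qP.
have card_cover :
    (#|points :\ p| <= \sum_(l in lines | p \proper l) #|on l :\ p|)%N.
  apply: leq_trans (subset_leq_card cover) _.
  elim/big_ind2: _ => [|m A n B Am Bn|//]; first by rewrite cards0.
  by rewrite (leq_trans (leq_card_setU A B)) // leq_add.
rewrite (cardsD1 p) pP -addnA add1n addn1 ltnS.
by rewrite (leq_trans _ le_on) // leq_add2r.
Qed.

(** The incidences are counted by line in the second Whitney number, but by
    point when the flags consisting of one point are summed. *)
Lemma incidences_dual :
  incidences M = (\sum_(p in points) #|[set l in lines | p \proper l]|)%N.
Proof.
rewrite /incidences; under eq_bigr do rewrite -sum1_card.
under [in RHS]eq_bigr do rewrite -sum1_card.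
rewrite (exchange_big_dep (mem points)) /=; last by move=> l p _; rewrite inE => /andP[].
apply: eq_bigr => p pP; apply: eq_bigl => l.
by rewrite [p \in _]in_set pP [RHS]in_set.
Qed.

Lemma proper_flats_mrank3 : proper_flats M = points :|: lines.
Proof.
apply/setP=> X; rewrite in_proper_flats r3 !inE -andb_orr.
by case: (rank M X) => [|[|[]]].
Qed.

Lemma disjoint_points_lines : [disjoint points & lines].
Proof.
rewrite -setI_eq0; apply/eqP/setP=> X; rewrite !inE.
by apply/negP=> /andP[/andP[_ /eqP->] /andP[_ /eqP]].
Qed.

Lemma sum_proper_flats3 (R : nmodType) (g : {set U} -> R) :
  \sum_(X in proper_flats M) g X = \sum_(p in points) g p + \sum_(l in lines) g l.
Proof.
rewrite -bigU ?disjoint_points_lines //; apply: eq_bigl => X.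
by rewrite proper_flats_mrank3 in_setU.
Qed.

Lemma between_bottom_line l : l \in lines ->
  [set Z in flats M | (bottom M \proper Z) && (Z \proper l)] =
    [set p in points | p \proper l].
Proof.
case/levelP=> lf rl; apply/setP=> Z; rewrite !inE; case Zf: (Z \in flats M) => //=.
case Zl: (Z \proper l); rewrite ?andbF // !andbT.
have := rank_lt Zf lf Zl; rewrite rl.
have -> : bottom M \proper Z = (0 < rank M Z)%N.
  by rewrite rank_gt0 // properEneq bottom_sub // andbT eq_sym.
by case: (rank M Z) => [|[]].
Qed.

Lemma between_point_ground p : p \in points ->
  [set Z in flats M | (p \proper Z) && (Z \proper ground M)] =
    [set l in lines | p \proper l].
Proof.
case/levelP=> pf rp; apply/setP=> Z; rewrite !inE; case Zf: (Z \in flats M) => //=.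
rewrite andbC; case pZ: (p \proper Z); rewrite ?andbF // !andbT.
have := rank_lt pf Zf pZ; have := rank_le Zf; rewrite r3 rp.
rewrite properEneq flat_sub // andbT -rank_top // r3.
by case: (rank M Z) => [|[|[|[]]]].
Qed.

Lemma flag_poincare_point p : p \in points ->
  flag_poincare M [set p] =
    (1 + 'X) ^+ 2 * (1 + (#|[set l in lines | p \proper l]|%:Z - 1)%:~R * 'X).
Proof.
move=> pP; case/levelP: (pP) => pf rp; have [l lL pl] := point_on_line pP.
case/levelP: lL => lf rl.
rewrite flag_poincare1 poincare_minor1 ?rank_bottom ?bottom_flat //; last first.
  by rewrite bottom_proper // -rank_gt0 // rp.
rewrite (@poincare_minor2 _ _ _ _ l) ?ground_flat ?between_point_ground //.
- by rewrite mulrA -expr2.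
- by rewrite properEneq flat_sub // andbT -rank_top // rl r3.
by rewrite -/(mrank M) r3 rp.
Qed.

Lemma flag_poincare_line l : l \in lines ->
  flag_poincare M [set l] =
    (1 + 'X) ^+ 2 * (1 + (#|[set p in points | p \proper l]|%:Z - 1)%:~R * 'X).
Proof.
move=> lL; case/levelP: (lL) => lf rl; have [p pP pl] := exists_point lL.
case/levelP: pP => pf rp.
rewrite flag_poincare1 (@poincare_minor2 _ _ _ _ p) //
  ?bottom_flat ?between_bottom_line //.
- rewrite poincare_minor1 ?ground_flat //; first by ring.
    by rewrite properEneq flat_sub // andbT -rank_top // rl r3.
  by rewrite -/(mrank M) r3 rl.
- by rewrite bottom_proper // -rank_gt0 // rp.
by rewrite rl rank_bottom.
Qed.

Lemma flag_poincare_point_line p l : p \in points -> l \in lines -> p \proper l ->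
  flag_poincare M [set p; l] = (1 + 'X) ^+ 3.
Proof.
case/levelP=> pf rp /levelP[lf rl] pl.
rewrite flag_poincare2 // !poincare_minor1 //
  ?rp ?rl ?rank_bottom ?bottom_flat ?ground_flat //.
  by rewrite properEneq flat_sub // andbT -rank_top // rl r3.
by rewrite bottom_proper // -rank_gt0 // rp.
Qed.

(** Points and lines satisfy the same formula with different counts [k]; both
    counts add up to the number of incidences. *)
Lemma sum_flag_poincare1 (S : {set {set U}}) (k : {set U} -> nat) :
  (forall X, X \in S -> flag_poincare M [set X] =
    (1 + 'X) ^+ 2 * (1 + ((k X)%:Z - 1)%:~R * 'X)) ->
  \sum_(X in S) flag_poincare M [set X] = (1 + 'X) ^+ 2 *
    (#|S|%:Z%:~R + ((\sum_(X in S) k X)%N%:Z - #|S|%:Z)%:~R * 'X).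
Proof. by move=> piS; rewrite (eq_bigr _ piS) -big_distrr sum_linear_factors. Qed.

Lemma sum_flag_poincare2 :
  \sum_(X in proper_flats M) \sum_(Y in proper_flats M | X \proper Y)
    flag_poincare M [set X; Y] = (incidences M)%:Z%:~R * (1 + 'X) ^+ 3.
Proof.
rewrite sum_proper_flats3 [X in _ + X]big1 => [|l lL]; last first.
  apply: big1 => X /andP[]; rewrite proper_flats_mrank3 => XP lX.
  case/levelP: lL => lf rl; case/setUP: XP => /levelP[Xf rX];
    by have := rank_lt lf Xf lX; rewrite rl rX.
rewrite addr0 incidences_dual -pmulrn natr_sum big_distrl; apply: eq_bigr => p pP /=.
rewrite -sum1_card natr_sum big_distrl /=; apply: eq_big => [l|l].
  rewrite proper_flats_mrank3 in_setU [RHS]in_set.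
  by case: (boolP (l \in points)) => //= /(level_properF pP)->; rewrite andbF.
case/andP; rewrite proper_flats_mrank3 => /setUP[/(level_properF pP)->//|lL pl].
by rewrite flag_poincare_point_line // mul1r.
Qed.
End RankThree.

(** * The explicit coarse flag polynomials *)

(** The coarse flag polynomial in rank 2, for b + 1 points. *)
Definition palindrome2 (b : int) : {poly {poly int}} :=
  let y : {poly {poly int}} := 'X%:P in
  (1 + y) * ((1 + b%:~R * y) + (b%:~R + y) * 'X).

(** The common form of the coarse flag polynomials in rank 3; the 3 x 3 array of
    coefficients of the second factor is invariant under rotation by a half
    turn. *)
Definition palindrome3 (a w s d : int) : {poly {poly int}} :=
  let y : {poly {poly int}} := 'X%:P in
  (1 + y) * ((1 + a%:~R * y + w%:~R * y ^+ 2) +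
    (s%:~R + d%:~R * y + s%:~R * y ^+ 2) * 'X +
    (w%:~R + a%:~R * y + y ^+ 2) * 'X ^+ 2).

Lemma coarse_flag_poly_mrank1 (U : finType) (M : matroid U) :
  simple_matroid M -> mrank M = 1%N -> coarse_flag_poly M = 1 + 'X%:P.
Proof.
move=> sM r1; rewrite /coarse_flag_poly sum_flags ?r1 //.
have np : proper_flats M =i pred0.
  by move=> X; rewrite in_proper_flats r1; case: (rank M X) => [|r]; rewrite andbF.
rewrite !(big_pred0 _ _ _ _ np) !addr0 flag_poincare0 poincare_minor_full //.
by rewrite poincare_mrank1 // cards0 !mulr1 rmorphD rmorph1.
Qed.

Lemma coarse_flag_poly_mrank2 (U : finType) (M : matroid U) :
  simple_matroid M -> mrank M = 2%N ->
  coarse_flag_poly M = palindrome2 (#|level M 1|%:Z - 1).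
Proof.
move=> sM r2; rewrite /palindrome2; set y : {poly {poly int}} := 'X%:P.
set b := _%:~R.
rewrite /coarse_flag_poly sum_flags ?r2 // -level1_mrank2 //.
rewrite [X in _ + (_ + X)]big1 => [|X Xp]; last first.
  by apply: big1 => Y /andP[Yp]; rewrite (level_properF Xp Yp).
rewrite (eq_bigr (fun=> (1 + y) ^+ 2 * 'X)) => [|X Xp]; last first.
  case/levelP: Xp => Xf rX.
  have Xb : bottom M \proper X by rewrite bottom_proper // -rank_gt0 // rX.
  have XE : X \proper ground M by rewrite properEneq flat_sub // -rank_top // rX r2.
  rewrite cards1 flag_poincare1 !poincare_minor1 ?bottom_flat ?ground_flat //.
  - by rewrite !(rmorphM, rmorphD, rmorph1) /= mulr1.
  - by rewrite -/(mrank M) r2 rX.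
  by rewrite rank_bottom.
rewrite sumr_const flag_poincare0 poincare_minor_full // poincare_mrank2 // cards0.
rewrite !(rmorphM, rmorphD, rmorph_int, rmorph1) /= -/y /b.
ring.
Qed.

Lemma coarse_flag_poly_mrank3 (U : finType) (M : matroid U)
    (n : int := #|level M 1|%:Z) (c : int := #|level M 2|%:Z)
    (I : int := (incidences M)%:Z) :
  simple_matroid M -> mrank M = 3%N ->
  coarse_flag_poly M =
    palindrome3 (n - 1) (1 - n + I - c) (n + c - 2) (2 * (I - n + 1)).
Proof.
move=> sM r3; rewrite /coarse_flag_poly sum_flags ?r3 // cards0.
rewrite (eq_bigr (fun X => (flag_poincare M [set X])%:P * ('X * (1 - 'X))));
  last by move=> X _; rewrite cards1 -mulrA.
rewrite -big_distrl -rmorph_sum (sum_proper_flats3 r3) /=.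
rewrite (sum_flag_poincare1 (flag_poincare_point r3)).
rewrite (sum_flag_poincare1 (flag_poincare_line r3)).
rewrite -incidences_dual -/(incidences M).
rewrite [X in _ + (_ + X)](_ : _ =
    ((incidences M)%:Z%:~R * (1 + 'X) ^+ 3)%:P * 'X ^+ 2); last first.
  rewrite -(sum_flag_poincare2 r3) rmorph_sum big_distrl.
  apply: eq_bigr => X _ /=; rewrite rmorph_sum big_distrl.
  by apply: eq_bigr => Y /andP[_ XY] /=; rewrite cards2 (proper_neq XY) mulr1.
rewrite flag_poincare0 poincare_minor_full // poincare_mrank3 //.
rewrite -/n -/c -/I !(rmorphM, rmorphD, rmorphXn, rmorph_int, rmorph1) /=.
rewrite /palindrome3; ring.
Qed.

(** * Nonnegativity *)

Lemma polyC_int (R : nzRingType) (m : int) : (m%:~R)%:P = m%:~R :> {poly R}.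
Proof. by rewrite rmorph_int. Qed.

Definition coef_ge0 (N : {poly {poly int}}) : Prop := forall i j, 0 <= N`_i`_j.

Lemma coef_ge0D (N N' : {poly {poly int}}) :
  coef_ge0 N -> coef_ge0 N' -> coef_ge0 (N + N').
Proof. by move=> N0 N'0 i j; rewrite !coefD addr_ge0. Qed.

Lemma coef_ge0M (N N' : {poly {poly int}}) :
  coef_ge0 N -> coef_ge0 N' -> coef_ge0 (N * N').
Proof.
move=> N0 N'0 i j; rewrite coefM coef_sum; apply: sumr_ge0 => k _.
by rewrite coefM; apply: sumr_ge0 => l _; rewrite mulr_ge0.
Qed.

Lemma coef_ge0_int (m : int) : 0 <= m -> coef_ge0 m%:~R.
Proof.
move=> m0 i j; rewrite -!polyC_int coefC; case: ifP => _; last by rewrite coef0.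
by rewrite coefC intz; case: ifP.
Qed.

Lemma coef_ge01 : coef_ge0 1.
Proof. exact: (@coef_ge0_int 1). Qed.

Lemma coef_ge0X : coef_ge0 'X.
Proof.
by move=> i j; rewrite coefX; case: eqP => _; rewrite ?coef0 // coef1; case: eqP.
Qed.

Lemma coef_ge0C : coef_ge0 'X%:P.
Proof.
by move=> i j; rewrite coefC; case: eqP => _; rewrite ?coef0 // coefX; case: eqP.
Qed.

(* Matching on the head symbol keeps unification from unfolding polynomial
   arithmetic in search of a sum or a product. *)
Ltac prove_coef_ge0 :=
  lazymatch goal with
  | |- coef_ge0 (_ + _) => apply: coef_ge0D; prove_coef_ge0
  | |- coef_ge0 (_ * _) => apply: coef_ge0M; prove_coef_ge0
  | |- coef_ge0 (_ ^+ 2) => rewrite expr2; prove_coef_ge0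
  | |- coef_ge0 1 => exact: coef_ge01
  | |- coef_ge0 'X => exact: coef_ge0X
  | |- coef_ge0 ('X%:P) => exact: coef_ge0C
  | |- coef_ge0 (_%:~R) => exact: coef_ge0_int
  end.

Lemma coef_ge0_palindrome2 (b : int) : 0 <= b -> coef_ge0 (palindrome2 b).
Proof. by move=> b0; rewrite /palindrome2 /=; prove_coef_ge0. Qed.

Lemma coef_ge0_palindrome3 (a w s d : int) :
  0 <= a -> 0 <= w -> 0 <= s -> 0 <= d -> coef_ge0 (palindrome3 a w s d).
Proof. by move=> a0 w0 s0 d0; rewrite /palindrome3 /=; prove_coef_ge0. Qed.

(** * The functional equation *)

Lemma eval2D (K : comNzRingType) (y t : K) (N N' : {poly {poly int}}) :
  eval2 (N + N') y t = eval2 N y t + eval2 N' y t.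
Proof. by rewrite /eval2 rmorphD !hornerE. Qed.

Lemma eval2M (K : comNzRingType) (y t : K) (N N' : {poly {poly int}}) :
  eval2 (N * N') y t = eval2 N y t * eval2 N' y t.
Proof. by rewrite /eval2 rmorphM !hornerE. Qed.

Lemma eval2_int (K : comNzRingType) (y t : K) (m : int) :
  eval2 m%:~R y t = m%:~R.
Proof. by rewrite /eval2 rmorph_int -!polyC_int !hornerE. Qed.

Lemma eval2X (K : comNzRingType) (y t : K) : eval2 'X y t = t.
Proof. by rewrite /eval2 map_polyX !hornerE. Qed.

Lemma eval2C (K : comNzRingType) (y t : K) : eval2 'X%:P y t = y.
Proof. by rewrite /eval2 map_polyC /= map_polyX !hornerE. Qed.

Lemma eval2_1 (K : comNzRingType) (y t : K) : eval2 1 y t = 1.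
Proof. exact: (eval2_int y t 1). Qed.

Definition eval2E := (eval2D, eval2M, eval2_int, eval2_1, eval2X, eval2C).

Lemma varY_neq0 : varY != 0.
Proof. by rewrite /varY tofrac_eq0 polyC_eq0 polyX_eq0. Qed.

Lemma varT_neq0 : varT != 0.
Proof. by rewrite /varT tofrac_eq0 polyX_eq0. Qed.

Lemma eval2_inv_palindrome1 (K : fieldType) (y t : K) : y != 0 ->
  eval2 (1 + 'X%:P) y^-1 t^-1 = y ^- 1 * t ^- 0 * eval2 (1 + 'X%:P) y t.
Proof. by move=> y0; rewrite !eval2E; field; rewrite oner_neq0. Qed.

Lemma eval2_inv_palindrome2 (K : fieldType) (y t : K) (b : int) :
  y != 0 -> t != 0 ->
  eval2 (palindrome2 b) y^-1 t^-1 = y ^- 2 * t ^- 1 * eval2 (palindrome2 b) y t.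
Proof.
by move=> y0 t0; rewrite /palindrome2 !eval2E; field; rewrite t0 y0.
Qed.

Lemma eval2_inv_palindrome3 (K : fieldType) (y t : K) (a w s d : int) :
  y != 0 -> t != 0 ->
  eval2 (palindrome3 a w s d) y^-1 t^-1 =
    y ^- 3 * t ^- 2 * eval2 (palindrome3 a w s d) y t.
Proof.
by move=> y0 t0; rewrite /palindrome3 !eval2E; field; rewrite t0 y0.
Qed.

(** * Real-rootedness *)

(** Turns evaluation at Y = y into the ring morphism [eval2], to which the
    simplification rules [eval2E] apply. *)
Lemma evalYE (C : comNzRingType) (N : {poly {poly int}}) (y : int) (z : C) :
  (map_poly (fun c : int => c%:~R) (evalY N y)).[z] = eval2 N y%:~R z.
Proof.
rewrite /evalY /eval2 -/(horner_eval y).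
elim/poly_ind: N => [|N c IH]; first by rewrite !rmorph0 !horner0.
rewrite !(rmorphD, rmorphM) /= !map_polyX !map_polyC !hornerE /= IH.
by rewrite /horner_eval -horner_map.
Qed.

Lemma real_rooted_one_plus_Y : real_rooted (evalY (1 + 'X%:P) 1).
Proof.
move=> C z; rewrite /root evalYE !eval2E.
by rewrite -[1 + 1]/(2%:R) pnatr_eq0.
Qed.

Lemma real_rooted_palindrome2 (b : int) :
  0 <= b -> real_rooted (evalY (palindrome2 b) 1).
Proof.
move=> b0 C z; rewrite /root evalYE /palindrome2 !eval2E => /eqP zr.
have : 2 * (b + 1)%:~R * (z + 1) = 0 :> C by rewrite -[RHS]zr; ring.
move/eqP; rewrite !mulf_eq0 pnatr_eq0 intr_eq0 /=.
have -> : (b + 1 == 0) = false by lia.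
by rewrite addr_eq0 /= => /eqP->; rewrite rpredN rpred1.
Qed.

(** Completing the square: (2Az + B)^2 is the discriminant B^2 - 4A^2, which is
    nonnegative. *)
Lemma real_root_quadratic (C : numClosedFieldType) (A B : int) (z : C) :
  0 < A -> 2 * A <= B -> A%:~R + B%:~R * z + A%:~R * z ^+ 2 = 0 ->
  z \is Num.real.
Proof.
move=> A0 AB qz; pose D : C := (B ^+ 2 - 4 * A ^+ 2)%:~R.
have sq : (2 * A%:~R * z + B%:~R) ^+ 2 = sqrtC D ^+ 2.
  have -> : (2 * A%:~R * z + B%:~R) ^+ 2 =
      4 * A%:~R * (A%:~R + B%:~R * z + A%:~R * z ^+ 2) + D by rewrite /D; ring.
  by rewrite qz mulr0 add0r sqrtCK.
have sqrt_real : sqrtC D \is @Num.real C.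
  by rewrite ger0_real // sqrtC_ge0 ler0z; nra.
have lin_real : 2 * A%:~R * z + B%:~R \is @Num.real C.
  by move/eqP: sq; rewrite eqf_sqr => /orP[]/eqP->; rewrite ?rpredN.
have A20 : 2 * A%:~R != 0 :> C by rewrite mulf_neq0 ?pnatr_eq0 // intr_eq0; lia.
have -> : z = (2 * A%:~R * z + B%:~R - B%:~R) / (2 * A%:~R).
  by rewrite addrK mulrAC divff // mul1r.
by rewrite rpred_div ?rpredB ?rpredM ?realz ?realn.
Qed.

Lemma real_rooted_palindrome3 (a w s d : int) :
  0 < 1 + a + w -> 2 * (1 + a + w) <= 2 * s + d ->
  real_rooted (evalY (palindrome3 a w s d) 1).
Proof.
move=> A0 AB C z; rewrite /root evalYE /palindrome3 !eval2E => /eqP zr.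
apply: (real_root_quadratic A0 AB); apply/eqP.
have : 2 * ((1 + a + w)%:~R + (2 * s + d)%:~R * z + (1 + a + w)%:~R * z ^+ 2)
    = 0 :> C by rewrite -[RHS]zr; ring.
by move/eqP; rewrite mulf_eq0 pnatr_eq0.
Qed.

Theorem corollary3p4 (U : finType) (M : matroid U) (Msimple : simple_matroid M)
    (Mrank : (1 <= mrank M <= 3)%N) :
  [/\ forall i j : nat, 0 <= ((coarse_flag_poly M)`_i)`_j,
      eval2 (coarse_flag_poly M) varY^-1 varT^-1 =
        varY ^- mrank M * varT ^- (mrank M - 1)
          * eval2 (coarse_flag_poly M) varY varT
    & real_rooted (evalY (coarse_flag_poly M) 1)].
Proof.
move: Mrank; case r: (mrank M) => [|[|[|[|]]]] // _.
- rewrite coarse_flag_poly_mrank1 //; split.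
  + by apply: coef_ge0D; [exact: coef_ge01 | exact: coef_ge0C].
  + exact (eval2_inv_palindrome1 varT varY_neq0).
  + exact: real_rooted_one_plus_Y.
- rewrite coarse_flag_poly_mrank2 //.
  have n1 : 0 <= #|level M 1|%:Z - 1 :> int.
    have [|p pP _] := @exists_point _ M (ground M).
      by rewrite inE ground_flat -/(mrank M) r.
    by rewrite subr_ge0 lez_nat; apply/card_gt0P; exists p.
  split.
  + exact: coef_ge0_palindrome2.
  + exact (eval2_inv_palindrome2 _ varY_neq0 varT_neq0).
  + exact: real_rooted_palindrome2.
- rewrite coarse_flag_poly_mrank3 //.
  have := points_lines_incidences r; have [l lL] := exists_line r.
  have [p pP _] := exists_point lL.
  have : (0 < #|level M 1|)%N by apply/card_gt0P; exists p.
  have : (0 < #|level M 2|)%N by apply/card_gt0P; exists l.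
  move: #|level M 1| #|level M 2| (incidences M) => n c I c0 n0 ncI.
  split.
  + by apply: coef_ge0_palindrome3; lia.
  + exact (eval2_inv_palindrome3 _ _ _ _ varY_neq0 varT_neq0).
  + by apply: real_rooted_palindrome3; lia.
Qed.
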